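(* Let $d\ge2$, let $Y$ be a real random variable, $R$ a $\{0,1\}$-valued random variable, $\boldsymbol{X}$ a random vector, $\boldsymbol{Z}$ a random vector in $\mathbb{R}^{d-1}$, and $(A,\boldsymbol{B}^\top)^\top$ an unobservable random vector in $\mathbb{R}^d$ with $R=1\{A+\boldsymbol{B}^\top\boldsymbol{Z}>0\}$. Set $$\boldsymbol{\Gamma}^\top=\frac{(A,\boldsymbol{B}^\top)}{\|(A,\boldsymbol{B}^\top)\|}1\{(A,\boldsymbol{B}^\top)\ne0\},\qquad \boldsymbol{S}^\top=\frac{(1,\boldsymbol{Z}^\top)}{\|(1,\boldsymbol{Z}^\top)\|},$$ so that $R=1\{\boldsymbol{\Gamma}^\top\boldsymbol{S}>0\}$, and let $H^+=\{\boldsymbol{s}\in\mathbb{S}^{d-1}:\boldsymbol{s}_1\ge0\}$. Assume that, for all $\boldsymbol{x}\in\mathrm{supp}(\boldsymbol{X})$: (a) $\mathbb{P}(\boldsymbol{\Gamma}=0|\boldsymbol{X}=\boldsymbol{x})=0$; (b) $\boldsymbol{S}$ is independent of $(\boldsymbol{\Gamma}^\top,Y)$ given $\boldsymbol{X}$; (c) the conditional law of $\boldsymbol{\Gamma}$ given $\boldsymbol{X}=\boldsymbol{x}$ is absolutely continuous with respect to $\sigma$, with density $f_{\boldsymbol{\Gamma}|\boldsymbol{X}=\boldsymbol{x}}\in L^2(\mathbb{S}^{d-1})$; (d) for a.e. $\boldsymbol{\gamma}\in\mathbb{S}^{d-1}$, $f_{\boldsymbol{\Gamma}|\boldsymbol{X}=\boldsymbol{x}}(\boldsymbol{\gamma})\,f_{\boldsymbol{\Gamma}|\boldsymbol{X}=\boldsymbol{x}}(-\boldsymbol{\gamma})=0$;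 (e) $\mathrm{supp}(\boldsymbol{S}|\boldsymbol{X}=\boldsymbol{x})=H^+$. Then, for every bounded measurable $\phi:\mathbb{R}\to\mathbb{R}$, every $\tilde{\boldsymbol{s}}$ on the boundary of $H^+$ and every $\boldsymbol{x}\in\mathrm{supp}(\boldsymbol{X})$, $$\mathbb{E}[\phi(Y)|\boldsymbol{X}=\boldsymbol{x}]=\lim_{\boldsymbol{s}\to\tilde{\boldsymbol{s}},\ \boldsymbol{s}\in H^+}\mathbb{E}[\phi(Y)R|\boldsymbol{X}=\boldsymbol{x},\boldsymbol{S}=\boldsymbol{s}]+\lim_{\boldsymbol{s}\to-\tilde{\boldsymbol{s}},\ \boldsymbol{s}\in H^+}\mathbb{E}[\phi(Y)R|\boldsymbol{X}=\boldsymbol{x},\boldsymbol{S}=\boldsymbol{s}].$$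
   Context: $\mathbb{S}^{d-1}$ is the unit sphere of $\mathbb{R}^d$, $\sigma$ its spherical (surface) measure, $\|\cdot\|$ the Euclidean norm, and $\boldsymbol{s}_1$ the first coordinate of $\boldsymbol{s}$. The boundary of $H^+$ in $\mathbb{S}^{d-1}$ is $\{\boldsymbol{s}\in\mathbb{S}^{d-1}:\boldsymbol{s}_1=0\}$. $\mathrm{supp}(\boldsymbol{S}|\boldsymbol{X}=\boldsymbol{x})$ is the support of the conditional law of $\boldsymbol{S}$ given $\boldsymbol{X}=\boldsymbol{x}$. ''For all $\boldsymbol{x}\in\mathrm{supp}(\boldsymbol{X})$'' is literal on the discrete part of the law of $\boldsymbol{X}$ and means a.e. on the continuous part. Equalities of random variables are almost sure. The function $\boldsymbol{s}\mapsto\mathbb{E}[\phi(Y)R|\boldsymbol{X}=\boldsymbol{x},\boldsymbol{S}=\boldsymbol{s}]$ is taken to be its version that is continuous in $\boldsymbol{s}$ on $\mathrm{supp}(\boldsymbol{S}|\boldsymbol{X}=\boldsymbol{x})$. *)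

(* Defs.v *)
From HB Require Import structures.
From mathcomp Require Import all_boot all_order all_algebra.
From mathcomp Require Import all_classical all_reals all_analysis.
From mathcomp Require Import measurable_realfun.

Import Order.TTheory GRing.Theory Num.Theory.
Import numFieldNormedType.Exports.

Local Open Scope classical_set_scope.
Local Open Scope ring_scope.

(* The sigma-algebra on 'rV[T]_n generated by the coordinate maps, as the
   library does for n.-tuple T; for T = R it is the Borel sigma-algebra. *)
Definition rV_display : measure_display -> measure_display.
Proof. exact. Qed.

Section measurable_rV.
Context {d : measure_display} {T : measurableType d} {n : nat}.

Let coors : 'I_n -> 'rV[T]_n -> T := fun i v => v ord0 i.

Let rV_set0 : g_sigma_preimage coors set0.
Proof. exact: sigma_algebra0. Qed.

Let rV_setC A : g_sigma_preimage coors A -> g_sigma_preimage coors (~` A).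
Proof. exact: sigma_algebraC. Qed.

Let rV_bigcup (F : (set 'rV[T]_n)^nat) :
  (forall i, g_sigma_preimage coors (F i)) ->
  g_sigma_preimage coors (\bigcup_i (F i)).
Proof. exact: sigma_algebra_bigcup. Qed.

HB.instance Definition _ := @isMeasurable.Build (rV_display d)
  'rV[T]_n (g_sigma_preimage coors) rV_set0 rV_setC rV_bigcup.

End measurable_rV.

Lemma measurable_coor {d : measure_display} {T : measurableType d} {n : nat}
  (i : 'I_n) : measurable_fun [set: 'rV[T]_n] (fun v : 'rV[T]_n => v ord0 i).
Proof.
move=> _ Y mY; rewrite setTI; apply: sub_sigma_algebra => /=.
rewrite -bigcup_seq/=; exists i => /=; first by rewrite mem_index_enum.
by exists Y => //; rewrite setTI.
Qed.

Lemma measurable_fun_rVP {d1 d2 : measure_display} {T1 : measurableType d1}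
    {T2 : measurableType d2} {n : nat} (f : T1 -> 'rV[T2]_n) :
  measurable_fun [set: T1] f <->
  forall i, measurable_fun [set: T1] (fun t => f t ord0 i).
Proof.
split=> [mf i|mf].
  exact: (measurableT_comp (measurable_coor i) mf).
move=> _; apply: (@measurability _ _ _ _ setT f) => //.
move=> _ [B + <-].
rewrite -bigcup_seq/= => -[i _ [C mC <-]].
rewrite [X in measurable (_ `&` X)](_ : _ = (fun t => f t ord0 i) @^-1` C).
  exact: mf.
by apply/seteqP; split => t/=; rewrite ?setTI//; case.
Qed.

Section euclidean.
Context {R : realType}.

(* The library norm `|v| on 'rV[R]_n is the maximum norm. *)
Definition enorm {n : nat} (v : 'rV[R]_n) : R := Num.sqrt (\sum_(i < n) v ord0 i ^+ 2).

Definition unitv {n : nat} (v : 'rV[R]_n) : 'rV[R]_n := (enorm v)^-1 *: v.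

Definition rV_cons {n : nat} (a : R) (v : 'rV[R]_n) : 'rV[R]_n.+1 :=
  row_mx (a%:M : 'rV_1) v.

Definition sphere (n : nat) : set 'rV[R]_n := [set s | enorm s = 1].

Definition Hplus (n : nat) : set 'rV[R]_n.+1 := [set s | sphere n.+1 s /\ 0 <= s ord0 ord0].

(* Boundary of Hplus relative to the sphere. *)
Definition bdHplus (n : nat) : set 'rV[R]_n.+1 :=
  [set s | sphere n.+1 s /\ s ord0 ord0 = 0].

Lemma measurable_enorm n : measurable_fun [set: 'rV[R]_n] (@enorm n).
Proof.
apply: measurableT_comp.
  exact: (continuous_measurable_fun (@sqrt_continuous R)).
by apply: measurable_sum => i; apply: measurable_funX; exact: measurable_coor.
Qed.

Lemma measurable_unitv n : measurable_fun [set: 'rV[R]_n] (@unitv n).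
Proof.
apply/measurable_fun_rVP => i.
rewrite (_ : (fun _ => _) =
    (fun v : 'rV[R]_n => (enorm v `^ (-1)) * v ord0 i)); last first.
  by apply/funext => v; rewrite mxE powR_inv1// sqrtr_ge0.
apply: measurable_funM; last exact: measurable_coor.
exact: (measurableT_comp (measurable_powR (-1)) (@measurable_enorm n)).
Qed.

Lemma rV_cons0 n (a : R) (v : 'rV[R]_n) : rV_cons a v ord0 ord0 = a.
Proof. by rewrite mxE; case: splitP => // j _; rewrite mxE !ord1. Qed.

Lemma rV_consS n (a : R) (v : 'rV[R]_n) i :
  rV_cons a v ord0 (lift ord0 i) = v ord0 i.
Proof.
rewrite mxE; case: splitP => [j|j]; first by rewrite ord1.
by rewrite lift0 add1n => -[ij]; congr (v _ _); exact/val_inj.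
Qed.

Lemma measurable_rV_cons {d : measure_display} {T : measurableType d} n
    (a : T -> R) (v : T -> 'rV[R]_n) :
  measurable_fun setT a -> measurable_fun setT v ->
  measurable_fun setT (fun t => rV_cons (a t) (v t)).
Proof.
move=> ma /measurable_fun_rVP mv; apply/measurable_fun_rVP => i.
have [j ->|->] := unliftP ord0 i.
  by under eq_fun do rewrite rV_consS; exact: mv.
by under eq_fun do rewrite rV_cons0.
Qed.

End euclidean.

(* n-dimensional Lebesgue measure, by iterating the product with the
   one-dimensional one. *)
Section lebesgue_rV.
Context {R : realType}.
Local Open Scope ereal_scope.

Section step.
Variables (n : nat) (mu : {sigma_finite_measure set 'rV[R]_n -> \bar R}).

Let f (q : measurableTypeR R * 'rV[R]_n) : 'rV[R]_n.+1 := rV_cons q.1 q.2.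

Let mf : measurable_fun setT f.
Proof. exact: measurable_rV_cons. Qed.

Definition lebesgue_rVS : set 'rV[R]_n.+1 -> \bar R :=
  pushforward (@lebesgue_measure R \x mu) f.

Let lebesgue_rVS0 : lebesgue_rVS set0 = 0.
Proof. by rewrite /lebesgue_rVS /pushforward preimage_set0 measure0. Qed.

Let lebesgue_rVS_ge0 A : 0 <= lebesgue_rVS A.
Proof. exact: measure_ge0. Qed.

Let lebesgue_rVS_sigma_additive : semi_sigma_additive lebesgue_rVS.
Proof.
by apply: measure_semi_sigma_additive; exact: mf.
Qed.

HB.instance Definition _ := isMeasure.Build _ _ _ lebesgue_rVS
  lebesgue_rVS0 lebesgue_rVS_ge0 lebesgue_rVS_sigma_additive.

Let lebesgue_rVS_sigma_finite : sigma_finite setT lebesgue_rVS.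
Proof.
have /sigma_finiteP[F [TF ndF Foo]] := sigma_finiteT (@lebesgue_measure R).
have /sigma_finiteP[G [TG ndG Goo]] := sigma_finiteT mu.
pose g (w : 'rV[R]_n.+1) : measurableTypeR R * 'rV[R]_n :=
  (w ord0 ord0, \row_i w ord0 (lift ord0 i)).
have mg : measurable_fun setT g.
  apply: measurable_fun_pair; first exact: measurable_coor.
  apply/measurable_fun_rVP => i.
  by under eq_fun do rewrite mxE; exact: measurable_coor.
have fK : cancel f g.
  move=> [a v]; rewrite /f /g/= rV_cons0; congr (_, _).
  by apply/rowP => i; rewrite mxE rV_consS.
exists (fun k => g @^-1` (F k `*` G k)).
  rewrite -preimage_bigcup [X in _ @^-1` X](_ : _ = setT) ?preimage_setT//.
  rewrite -setXTT TF TG predeqE => -[x y]; split.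
    by move=> [k _ []/= ? ?]; split; exists k.
  move=> [/= [i _ Fix] [k _ Gky]]; exists (maxn i k) => //; split.
  - by move: x Fix; exact/subsetPset/ndF/leq_maxl.
  - by move: y Gky; exact/subsetPset/ndG/leq_maxr.
move=> k; have [mF Fkoo] := Foo k; have [mG Gkoo] := Goo k; split.
  by rewrite -[X in measurable X]setTI; apply: mg => //; exact: measurableX.
rewrite /lebesgue_rVS /pushforward.
rewrite [X in (_ \x _) X < _](_ : _ = F k `*` G k).
  by rewrite product_measure1E// lte_mul_pinfty// ge0_fin_numE.
by apply/seteqP; split => q; rewrite /preimage /mkset fK.
Qed.

HB.instance Definition _ := Measure_isSigmaFinite.Build _ _ _ lebesgue_rVS
  lebesgue_rVS_sigma_finite.

End step.

Fixpoint lebesgue_rV (n : nat) : {sigma_finite_measure set 'rV[R]_n -> \bar R} :=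
  if n is m.+1 then lebesgue_rVS m (lebesgue_rV m) else \d_ (0%R : 'rV[R]_0).

End lebesgue_rV.

Section surface_measure.
Context {R : realType}.

Definition punctured_ball (n : nat) : set 'rV[R]_n := [set v | 0 < enorm v <= 1].

Lemma measurable_punctured_ball n : measurable (punctured_ball n).
Proof.
rewrite (_ : punctured_ball n = setT `&` @enorm R n @^-1` `]0, 1]%classic).
  by apply: (measurable_enorm n) => //; exact: measurable_itv.
by rewrite setTI; apply/seteqP; split => v /=; rewrite in_itv.
Qed.

(* Polar-coordinates definition of the surface measure of the unit sphere, as
   a measure on the whole of 'rV[R]_n carried by the sphere:
     sphere_measure n A = n * Leb_n {v | 0 < |v| <= 1, v / |v| \in A}. *)
Definition sphere_measure (n : nat) (A : set 'rV[R]_n) : \bar R :=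
  (n%:R%:E * lebesgue_rV n (unitv @^-1` A `&` punctured_ball n))%E.

Section sphere_measure_measure.
Variable n : nat.

Let sphere_measure0 : sphere_measure n set0 = 0%E.
Proof. by rewrite /sphere_measure preimage_set0 set0I measure0 mule0. Qed.

Let sphere_measure_ge0 A : (0 <= sphere_measure n A)%E.
Proof. by rewrite mule_ge0. Qed.

Let sphere_measure_sigma_additive : semi_sigma_additive (sphere_measure n).
Proof.
apply: (@measure_semi_sigma_additive _ _ _ (mscale n%:R%:nng (pushforward
  (mrestr (lebesgue_rV n) (measurable_punctured_ball n)) (@unitv R n)))).
exact: measurable_unitv.
Qed.

HB.instance Definition _ := isMeasure.Build _ _ _ (sphere_measure n)
  sphere_measure0 sphere_measure_ge0 sphere_measure_sigma_additive.

End sphere_measure_measure.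

End surface_measure.

Section probability_notions.
Context {R : realType}.

Definition msupport {T : topologicalType} (mu : set T -> \bar R) : set T :=
  [set s | forall U, open U -> U s -> (0 < mu U)%E].

(* K is a regular conditional law of V given X. *)
Definition is_cond_law {d d1 d2 : measure_display} {Omega : measurableType d}
    {T1 : measurableType d1} {T2 : measurableType d2}
    (P : probability Omega R) (X : Omega -> T1) (V : Omega -> T2)
    (K : R.-pker T1 ~> T2) : Prop :=
  forall A B, measurable A -> measurable B ->
    P (X @^-1` A `&` V @^-1` B) = (\int[P]_(w in X @^-1` A) K (X w) B)%E.

(* h is a version of v |-> E[W | V = v]. *)
Definition is_cond_exp {d d1 : measure_display} {Omega : measurableType d}
    {T1 : measurableType d1} (P : probability Omega R) (V : Omega -> T1)
    (W : Omega -> R) (h : T1 -> R) : Prop :=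
  [/\ measurable_fun setT h,
      P.-integrable setT (EFin \o (h \o V)) &
      forall B, measurable B ->
        (\int[P]_(w in V @^-1` B) (h (V w))%:E =
         \int[P]_(w in V @^-1` B) (W w)%:E)%E].

(* nu has density f with respect to mu (hence nu `<< mu). *)
Definition is_density {d : measure_display} {T : measurableType d}
    (mu nu : set T -> \bar R) (f : T -> R) : Prop :=
  [/\ measurable_fun setT f, (forall t, 0 <= f t) &
      forall B, measurable B -> (nu B = \int[mu]_(t in B) (f t)%:E)%E].

End probability_notions.

Section model.
Context {R : realType} {T : Type} {n : nat}.

Definition Gamma (A : T -> R) (B : T -> 'rV[R]_n) (w : T) : 'rV[R]_n.+1 :=
  unitv (rV_cons (A w) (B w)) *+ (rV_cons (A w) (B w) != 0).

Definition Svec (Z : T -> 'rV[R]_n) (w : T) : 'rV[R]_n.+1 :=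
  unitv (rV_cons 1 (Z w)).

End model.

(* Marginals of a law mu of (S, (Gamma, Y)). *)
Section marginals.
Context {R : realType} {n : nat}.
Variable mu : set ('rV[R]_n.+1 * ('rV[R]_n.+1 * R)) -> \bar R.

Definition lawS : set 'rV[R]_n.+1 -> \bar R := pushforward mu fst.

Definition lawGY : set ('rV[R]_n.+1 * R) -> \bar R := pushforward mu snd.

Definition lawG : set 'rV[R]_n.+1 -> \bar R := pushforward lawGY fst.

End marginals.

(* Main.v *)
Require Import Defs.
From HB Require Import structures.
From mathcomp Require Import all_boot all_order all_algebra.
From mathcomp Require Import all_classical all_reals all_analysis.
From mathcomp Require Import measurable_realfun lra.
Import Order.TTheory GRing.Theory Num.Theory.
Import numFieldNormedType.Exports.
Local Open Scope classical_set_scope.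
Local Open Scope ring_scope.

(* For a fixed x, conditional independence turns E[phi(Y) R | X = x, S = s]
   into g_x(s) = E[phi(Y) 1{<Gamma, s> > 0} | X = x].  Hyperplanes through the
   origin are null for the surface measure, hence for the law of Gamma, so g_x
   is continuous away from the origin by continuity from above of that law on
   shrinking slabs around a hyperplane.  A version of the conditional
   expectation that is continuous on the support H+ coincides with g_x there;
   since s and -s both lie in H+ when s is on its boundary, the two limits are
   g_x(s) and g_x(-s), and the two open half-spaces {<., s> > 0} and
   {<., -s> > 0} cover everything but a null hyperplane. *)

Notation mpushforward :=
  measure_function_pushforward__canonical__measure_function_Measure
  (only parsing).

(** * Kernels, conditional laws and conditional expectations *)

Section kernels.
Context {d0 d1 d2 : measure_display} {T0 : measurableType d0}
  {T1 : measurableType d1} {T2 : measurableType d2} {R : realType}.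
Variable K : R.-pker T1 ~> T2.

Section precomposition.
Variables (g : T0 -> T1) (mg : measurable_fun setT g).

(** The measurability proof is an argument so that the kernel and probability structures below can
    be inferred from the term itself. *)
Definition kprecomp of measurable_fun setT g : T0 -> {measure set T2 -> \bar R} :=
  fun x => K (g x).

Let measurable_kprecomp U :
  measurable U -> measurable_fun setT (kprecomp mg ^~ U).
Proof. by move=> mU; exact: measurableT_comp (measurable_kernel K U mU) mg. Qed.

HB.instance Definition _ := isKernel.Build _ _ _ _ _ (kprecomp mg)
  measurable_kprecomp.

Let kprecomp_prob x : kprecomp mg x setT = 1%E.
Proof. exact: prob_kernel. Qed.

HB.instance Definition _ := Kernel_isProbability.Build _ _ _ _ _
  (kprecomp mg) kprecomp_prob.

End precomposition.

(** This is the product of the Dirac mass at [x.2] with [K x.2]. The dummy [unit] factor fits the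
    source type of [kcomp]: composed with the law of [X], seen as a kernel from [unit], it gives the
    joint law of [X] and [V]. *)
Definition kgraph (x : unit * T1) : {measure set (T1 * T2) -> \bar R} :=
  mpushforward (K x.2) (pair1_measurable x.2).

Lemma kgraphE x U : kgraph x U = K x.2 (xsection U x.2).
Proof. by rewrite xsectionE. Qed.

Let measurable_kgraph U :
  measurable U -> measurable_fun setT (kgraph ^~ U).
Proof.
move=> mU.
rewrite (_ : kgraph ^~ U = (fun x => K x (xsection U x)) \o snd); last first.
  by apply/funext => x; rewrite kgraphE.
apply: measurableT_comp => //.
by apply: measurable_fun_xsection_finite_kernel; rewrite inE.
Qed.

HB.instance Definition _ := isKernel.Build _ _ _ _ _ kgraph measurable_kgraph.

Let kgraph_prob x : kgraph x setT = 1%E.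
Proof. exact: prob_kernel. Qed.

HB.instance Definition _ := Kernel_isProbability.Build _ _ _ _ _
  kgraph kgraph_prob.

End kernels.

(** * Integrals of bounded functions against a probability *)

Section bounded_integrals.
Local Open Scope ereal_scope.
Context {d : measure_display} {T : measurableType d} {R : realType}.
Variables (mu : {measure set T -> \bar R}) (mu1 : mu setT = 1).
Variables (f : T -> R) (M : R).
Hypotheses (mf : measurable_fun setT f) (fM : forall x, (`|f x| <= M)%R).

Lemma bounded_integrable : mu.-integrable setT (EFin \o f).
Proof.
apply: measurable_bounded_integrable => //; first by rewrite mu1 ltry.
exists M; split; first exact: num_real.
by move=> N MN x _; exact: le_trans (fM x) (ltW MN).
Qed.

Lemma abse_integral_bounded : `|\int[mu]_x (f x)%:E| <= M%:E.
Proof.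
apply: le_trans (le_abse_integral _ _ _) _ => //; first exact/measurable_EFinP.
apply: (@le_trans _ _ (\int[mu]_x M%:E)); last first.
  by rewrite integral_cst// mu1 mule1.
apply: ge0_le_integral => //.
- by apply: measurableT_comp => //; exact/measurable_EFinP.
- by move=> x _; rewrite lee_fin fM.
Qed.

Lemma integral_bounded_fin_num : \int[mu]_x (f x)%:E \is a fin_num.
Proof. by apply: integrable_fin_num => //; exact: bounded_integrable. Qed.

Lemma integral_shift (c : R) :
  \int[mu]_x (f x + c)%:E = \int[mu]_x (f x)%:E + c%:E.
Proof.
under eq_integral do rewrite EFinD.
rewrite integralD//; last 2 first.
- exact: bounded_integrable.
- apply: (measurable_bounded_integrable (f := cst c)) => //.
    by rewrite mu1 ltry.
  by exists `|c|%R; split => //= N cN x _; exact: ltW.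
by rewrite integral_cst// mu1 mule1.
Qed.

End bounded_integrals.

Section kernel_means.
Context {d1 d2 : measure_display} {T1 : measurableType d1}
  {T2 : measurableType d2} {R : realType}.
Variables (K : R.-pker T1 ~> T2) (f : T1 * T2 -> R) (M : R).
Hypotheses (mf : measurable_fun setT f) (fM : forall z, `|f z| <= M).

Let mfx x : measurable_fun setT (fun y => f (x, y)).
Proof. exact: measurable_fun_pair2. Qed.

(** Real-valued, as [is_cond_exp] requires; [fine] loses nothing because the integral of a bounded
    function is finite. *)
Definition kmean x := fine (\int[K x]_y (f (x, y))%:E)%E.

Lemma kmeanE x : (kmean x)%:E = (\int[K x]_y (f (x, y))%:E)%E.
Proof.
rewrite /kmean fineK//.
by apply: integral_bounded_fin_num (mfx x) (fun y => fM _); exact: prob_kernel.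
Qed.

Lemma kmean_bounded x : `|kmean x| <= M.
Proof.
rewrite -lee_fin -abse_EFin kmeanE.
by apply: abse_integral_bounded (mfx x) (fun y => fM _); exact: prob_kernel.
Qed.

(** Measurability of kernel integrals is available for nonnegative integrands, so [f] is raised by
    its bound [M] and the constant is subtracted afterwards. *)
Lemma measurable_kmean : measurable_fun setT kmean.
Proof.
apply/measurable_EFinP.
rewrite (_ : EFin \o _ =
    (fun x => \int[K x]_y (f (x, y) + M)%:E - M%:E)%E); last first.
  apply/funext => x /=.
  rewrite (integral_shift _ (prob_kernel x) _ _ (mfx x) (fun y => fM _)).
  by rewrite addeK// kmeanE.
apply: emeasurable_funB => //.
apply: (measurable_fun_integral_finite_kernel (fun z => (f z + M)%:E)).
  by move=> z; rewrite lee_fin -lerBlDr sub0r; have /ler_normlP[] := fM z; rewrite lerNl.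
by apply/measurable_EFinP; exact: measurable_funD.
Qed.

End kernel_means.

(* Bounded functions reduce to nonnegative ones by adding a constant. *)
Lemma integral_kernel_bounded {d d1 d2 : measure_display}
    {T : measurableType d} {T1 : measurableType d1} {T2 : measurableType d2}
    {R : realType} (P : probability T R) (K : R.-pker T ~> T1)
    (Z : T -> T2) (Phi : T * T1 -> T2) (F : T2 -> R) (M : R) :
  measurable_fun setT Z -> measurable_fun setT Phi -> measurable_fun setT F ->
  (forall z, `|F z| <= M) ->
  (forall G : T2 -> \bar R, measurable_fun setT G -> (forall z, 0 <= G z)%E ->
    \int[P]_w G (Z w) = \int[P]_w \int[K w]_v G (Phi (w, v)))%E ->
  (\int[P]_w (F (Z w))%:E = \int[P]_w (kmean K (F \o Phi) w)%:E)%E.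
Proof.
move=> mZ mPhi mF FM.
move=> /(_ (fun z => (F z + M)%:E)).
have P1 : P setT = 1%E by exact: probability_setT.
have mFP : measurable_fun setT (F \o Phi) by exact: measurableT_comp.
have FMP z : `|(F \o Phi) z| <= M by exact: FM.
have mFZ : measurable_fun setT (F \o Z) by exact: measurableT_comp.
have FMZ z : `|(F \o Z) z| <= M by exact: FM.
rewrite (integral_shift _ P1 _ _ mFZ FMZ).
have -> : (\int[P]_w \int[K w]_v (F (Phi (w, v)) + M)%:E =
   \int[P]_w (kmean K (F \o Phi) w + M)%:E)%E.
  apply: eq_integral => w _; rewrite EFinD (kmeanE _ _ _ mFP FMP).
  have mFw : measurable_fun setT (fun v => (F \o Phi) (w, v)).
    exact: measurable_fun_pair2.
  by rewrite (integral_shift _ (prob_kernel w) _ _ mFw (fun v => FMP _)).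
rewrite (integral_shift _ P1 _ _ (measurable_kmean _ _ _ mFP FMP)
  (kmean_bounded _ _ _ mFP FMP)).
move=> h; rewrite -[LHS](@addeK _ M%:E)// h ?addeK//.
  by apply/measurable_EFinP; exact: measurable_funD.
by move=> z; rewrite lee_fin -lerBlDr sub0r; have /ler_normlP[] := FM z; rewrite lerNl.
Qed.

(** * Disintegration along a conditional law *)

Section conditional_law.
Local Open Scope ereal_scope.
Context {d d1 d2 : measure_display} {Omega : measurableType d}
  {T1 : measurableType d1} {T2 : measurableType d2} {R : realType}.
Variables (P : probability Omega R) (X : {RV P >-> T1}) (V : Omega -> T2).
Variables (mV : measurable_fun setT V) (K : R.-pker T1 ~> T2).
Hypothesis KV : is_cond_law P X V K.

Let XV w := (X w, V w).

Let mXV : measurable_fun setT XV.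
Proof. exact: measurable_fun_pair. Qed.

Let l : R.-pker unit ~> T1 :=
  kprobability (measurable_cst (distribution P X : pprobability T1 R)).

Let kgraphX A B : (kgraph K (tt, A) B) = K A (xsection B A).
Proof. exact: kgraphE. Qed.

Let kcomp_graphE A : measurable A ->
  kcomp l (kgraph K) tt A = \int[P]_w K (X w) (xsection A (X w)).
Proof.
move=> mA; rewrite /kcomp.
under eq_integral do rewrite kgraphX.
rewrite ge0_integral_distribution//.
by apply: measurable_fun_xsection_finite_kernel; rewrite inE.
Qed.

(** Both sides are finite measures in [A]. They agree on rectangles, by the definition of a
    conditional law, and rectangles form a generating class stable under intersection. *)
Lemma law_graph A : measurable A ->
  P (XV @^-1` A) = \int[P]_w K (X w) (xsection A (X w)).
Proof.
move=> mA; rewrite -kcomp_graphE//.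
pose C : set (set (T1 * T2)) :=
  [set C | exists A, measurable A /\ exists B, measurable B /\ C = A `*` B].
pose m1 := mpushforward P mXV.
apply: (measure_unique C (fun=> setT) _ _ _ _ m1 ) => //.
- rewrite measurable_prod_measurableType //; congr (<<s _ >>).
  rewrite predeqE; split => [[B mB [B' mB' <-]]|[B [mB [B' [mB' ->]]]]].
    by exists B; split => //; exists B'.
  by exists B => //; exists B'.
- move=> _ _ [X1 [mX1 [X2 [mX2 ->]]]] [Y1 [mY1 [Y2 [mY2 ->]]]].
  rewrite -setXI; exists (X1 `&` Y1); split; first exact: measurableI.
  by exists (X2 `&` Y2); split => //; exact: measurableI.
- by move=> _; exists setT; split => //; exists setT; split => //; rewrite setXTT.
- by rewrite bigcup_const//; exists 0%N.
- move=> _ [B1 [mB1 [B2 [mB2 ->]]]].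
  rewrite [RHS]kcomp_graphE; last exact: measurableX.
  rewrite /m1 /= /pushforward -[LHS]/(P (X @^-1` B1 `&` V @^-1` B2)) KV//.
  (* The section of [B1]*[B2] is [B2] or empty according to whether [X w] lies in [B1]. *)
  rewrite integral_mkcond; apply: eq_integral => w _ /=.
  rewrite patchE /=; case: ifPn => Bw.
    by rewrite in_xsectionX//; move: Bw; rewrite !inE.
  by rewrite notin_xsectionX ?measure0//; apply: contra Bw; rewrite !inE.
- by move=> _; rewrite /m1 /= /pushforward preimage_setT probability_setT ltry.
Qed.

(** The joint law of [X] and [V] is the composition of the law of [X] with [kgraph K], so its
    integrals are iterated ones. *)
Lemma ge0_disintegration (F : T1 * T2 -> \bar R) :
  measurable_fun setT F -> (forall z, 0 <= F z) ->
  \int[P]_w F (X w, V w) = \int[P]_w \int[K (X w)]_v F (X w, v).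
Proof.
move=> mF F0.
pose m1 := mpushforward P mXV.
have <- : \int[m1]_z F z = \int[P]_w F (X w, V w).
  by rewrite ge0_integral_pushforward.
rewrite (eq_measure_integral (kcomp l (kgraph K) tt)); last first.
  by move=> A mA _; rewrite /m1 /= /pushforward law_graph// kcomp_graphE.
rewrite integral_kcomp//.
have kgraphI x : \int[kgraph K (tt, x)]_z F z = \int[K x]_v F (x, v).
  by rewrite ge0_integral_pushforward//; exact: pair1_measurable.
under eq_integral do rewrite kgraphI.
rewrite ge0_integral_distribution//.
  exact: measurable_fun_integral_finite_kernel.
by move=> x; exact: integral_ge0.
Qed.

End conditional_law.

(** * Independence and freezing of a variable *)

Section measure_as_probability.
Context {d : measure_display} {T : measurableType d} {R : realType}.
Variable mu : {measure set T -> \bar R}.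

(* The argument carries the proof used by the probability instance. *)
Definition mprobability of mu setT = 1%E : set T -> \bar R := mu.

Variable mu1 : mu setT = 1%E.

HB.instance Definition _ := Measure.on (mprobability mu1).

HB.instance Definition _ :=
  Measure_isProbability.Build _ _ _ (mprobability mu1) mu1.

End measure_as_probability.

(** Independence makes [mu] the product of its marginals, and Tonelli applies. Both integrals are
    kept against [mu] itself, each reading a single component, so that a kernel can be substituted
    for [mu] directly. *)
Lemma ge0_integral_independent {d1 d2 : measure_display}
    {T1 : measurableType d1} {T2 : measurableType d2} {R : realType}
    (mu : {measure set (T1 * T2) -> \bar R}) (F : T1 * T2 -> \bar R) :
  mu setT = 1%E ->
  (forall A B, measurable A -> measurable B ->
    mu (A `*` B) = pushforward mu fst A * pushforward mu snd B)%E ->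
  measurable_fun setT F -> (forall z, 0 <= F z)%E ->
  (\int[mu]_z F z = \int[mu]_z \int[mu]_u F (z.1, u.2))%E.
Proof.
move=> mu1 muX mF F0.
pose m1 := mpushforward mu measurable_fst.
pose m2 := mpushforward mu measurable_snd.
have m11 : m1 setT = 1%E by rewrite /m1/= /pushforward preimage_setT.
have m21 : m2 setT = 1%E by rewrite /m2/= /pushforward preimage_setT.
(* Repackaging the marginals as probabilities makes them sigma-finite, as the product measure
   requires. *)
rewrite (eq_measure_integral (mprobability _ m11 \x mprobability _ m21)%E);
  last by move=> A mA _; apply/esym/product_measure_unique.
rewrite fubini_tonelli1//.
rewrite (eq_measure_integral m1 (m1 := mprobability _ m11))//.
rewrite ge0_integral_pushforward//=; last 2 first.
- exact: measurable_fun_fubini_tonelli_F.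
- by move=> x _; exact: integral_ge0.
apply: eq_integral => z _; rewrite /fubini_F/=.
rewrite (eq_measure_integral m2 (m1 := mprobability _ m21))//.
by rewrite ge0_integral_pushforward//; exact: measurable_fun_pair2.
Qed.

Section conditional_independence.
Local Open Scope ereal_scope.
Context {d d1 d2 d3 : measure_display} {Omega : measurableType d}
  {T1 : measurableType d1} {T2 : measurableType d2} {T3 : measurableType d3}
  {R : realType}.
Variables (P : probability Omega R) (X : {RV P >-> T1}) (S : Omega -> T2)
  (V : Omega -> T3).
Variables (mS : measurable_fun setT S) (mV : measurable_fun setT V).
Variable K : R.-pker T1 ~> (T2 * T3)%type.
Hypothesis KSV : is_cond_law P X (fun w => (S w, V w)) K.
Hypothesis indep : {ae distribution P X, forall x, forall A B,
  measurable A -> measurable B ->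
  K x (A `*` B) = pushforward (K x) fst A * pushforward (K x) snd B}.

(** Given [X], the variable [V] may be redrawn without regard to [S]: after disintegrating both
    sides along [X], the inner integrals agree for almost every [x] by independence under [K x]. *)
Lemma ge0_freezing (F : (T1 * T2) * T3 -> \bar R) :
  measurable_fun setT F -> (forall z, 0 <= F z) ->
  \int[P]_w F ((X w, S w), V w) =
  \int[P]_w \int[K (X w)]_v F ((X w, S w), v.2).
Proof.
move=> mF F0.
have mSV : measurable_fun setT (fun w => (S w, V w)).
  exact: measurable_fun_pair.
pose F1 (z : T1 * (T2 * T3)) := F ((z.1, z.2.1), z.2.2).
(* [G] is the right-hand inner integral with [x] and [s] frozen; the kernel is precomposed with
   [fst] so that joint measurability in the pair follows. *)
pose G (z : T1 * T2) := \int[kprecomp K fst measurable_fst z]_v F (z, v.2).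
have mF1 : measurable_fun setT F1.
  apply: (measurableT_comp mF); do !apply: measurable_fun_pair => //;
  exact: measurableT_comp.
have mG : measurable_fun setT G.
  apply: (measurable_fun_integral_finite_kernel (fun z => F (z.1, z.2.2))) => //.
  apply: (measurableT_comp mF); apply: measurable_fun_pair => //.
  exact: measurableT_comp.
have G0 z : 0 <= G z by exact: integral_ge0.
have mG1 : measurable_fun setT (fun z : T1 * (T2 * T3) => G (z.1, z.2.1)).
  apply: (measurableT_comp mG); apply: measurable_fun_pair => //.
  exact: (measurableT_comp measurable_fst measurable_snd).
transitivity (\int[P]_w ((fun x => \int[K x]_v F1 (x, v)) \o X) w).
  exact: (ge0_disintegration _ _ _ mSV _ KSV F1 mF1 (fun z => F0 _)).
transitivity (\int[P]_w ((fun x => \int[K x]_v G (x, v.1)) \o X) w); last first.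
  by apply/esym; exact: (ge0_disintegration _ _ _ mSV _ KSV
    (fun z : T1 * (T2 * T3) => G (z.1, z.2.1)) mG1 (fun z => G0 _)).
have m1 : measurable_fun setT (fun x => \int[K x]_v F1 (x, v)).
  exact: (measurable_fun_integral_finite_kernel F1 K (fun z => F0 _) mF1).
have m2 : measurable_fun setT (fun x => \int[K x]_v G (x, v.1)).
  exact: (measurable_fun_integral_finite_kernel
    (fun z : T1 * (T2 * T3) => G (z.1, z.2.1)) K (fun z => G0 _) mG1).
rewrite -[LHS]ge0_integral_distribution//; last first.
  by move=> x; apply: integral_ge0 => v _; exact: F0.
rewrite -[RHS]ge0_integral_distribution//; last first.
  by move=> x; apply: integral_ge0 => v _; exact: G0.
apply: ge0_ae_eq_integral => //.
- by move=> x _; apply: integral_ge0 => v _; exact: F0.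
- by move=> x _; apply: integral_ge0 => v _; exact: G0.
move: indep; apply: filterS => x KxX _.
rewrite (ge0_integral_independent _ (fun v => F1 (x, v)) (prob_kernel x) KxX)//.
  exact: measurable_fun_pair2.
by move=> z; exact: F0.
Qed.

End conditional_independence.

(** The assumed identity for nonnegative integrands passes to bounded ones, in particular to [f] cut
    off by a test set. [Psi] selects the part of the kernel's target that stands for [V]: [snd]
    after freezing, [idfun] for a plain disintegration. *)
Lemma is_cond_exp_kmean {d d1 d2 d3 : measure_display}
    {Omega : measurableType d} {T1 : measurableType d1}
    {T2 : measurableType d2} {T3 : measurableType d3} {R : realType}
    (P : probability Omega R) (U : Omega -> T1) (V : Omega -> T3)
    (K : R.-pker T1 ~> T2) (Psi : T2 -> T3) (f : T1 * T3 -> R) (M : R) :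
  measurable_fun setT U -> measurable_fun setT V -> measurable_fun setT Psi ->
  measurable_fun setT f -> (forall z, `|f z| <= M) ->
  (forall G : T1 * T3 -> \bar R, measurable_fun setT G ->
    (forall z, 0 <= G z) ->
    \int[P]_w G (U w, V w) = \int[P]_w \int[K (U w)]_v G (U w, Psi v))%E ->
  is_cond_exp P U (fun w => f (U w, V w))
    (kmean K (fun u => f (u.1, Psi u.2))).
Proof.
move=> mU mV mPsi mf fM h.
pose g (u : T1 * T2) := f (u.1, Psi u.2).
have mg : measurable_fun setT g.
  apply: (measurableT_comp mf); apply: measurable_fun_pair => //.
  exact: (measurableT_comp mPsi measurable_snd).
have gM u : `|g u| <= M by exact: fM.
have mkg := measurable_kmean K g M mg gM.
have kgM := kmean_bounded K g M mg gM.
have M0 : 0 <= M by exact: le_trans (fM (point, point)).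
split => //.
  apply: (bounded_integrable _ _ (kmean K g \o U) M) => //.
  - exact: probability_setT.
  - exact: measurableT_comp.
  - by move=> w; exact: kgM.
move=> B mB.
(* The test set is absorbed into the integrand, so both sides become integrals over the whole
   space. *)
pose F (z : T1 * T3) := \1_B z.1 * f z.
have mF : measurable_fun setT F.
  apply: measurable_funM => //.
  by apply: (measurableT_comp (measurable_indic mB)).
have FM z : `|F z| <= M.
  rewrite normrM indicE; case: (_ \in _).
    by rewrite normr1 mul1r.
  by rewrite normr0 mul0r.
pose Phi (u : Omega * T2) := (U u.1, Psi u.2).
have mPhi : measurable_fun setT Phi.
  by apply: measurable_fun_pair; apply: measurableT_comp.
rewrite integral_mkcond [RHS]integral_mkcond.
(* The indicator depends on [U w] only, hence is constant under the inner integral. *)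
transitivity (\int[P]_w (kmean (kprecomp K U mU) (F \o Phi) w)%:E)%E.
  apply: eq_integral => w _; rewrite patchE /kmean /kprecomp /F/=.
  rewrite indicE -[w \in _]/(U w \in B); case: (_ \in B).
    by under [in RHS]eq_integral do rewrite mul1r.
  by under [in RHS]eq_integral do rewrite mul0r; rewrite integral0.
rewrite -(integral_kernel_bounded P _ (fun w => (U w, V w)) Phi F M)//.
- apply: eq_integral => w _; rewrite patchE /F/=.
  by rewrite indicE -[w \in _]/(U w \in B); case: (_ \in B); rewrite ?mul1r ?mul0r.
- exact: measurable_fun_pair.
Qed.

(** Under the law of [U] the two versions have equal integrals over every measurable set, hence
    agree almost everywhere. *)
Lemma is_cond_exp_unique {d d1 : measure_display} {Omega : measurableType d}
    {T1 : measurableType d1} {R : realType} (P : probability Omega R)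
    (U : Omega -> T1) (W : Omega -> R) (h1 h2 : T1 -> R) :
  measurable_fun setT U -> is_cond_exp P U W h1 -> is_cond_exp P U W h2 ->
  measurable [set u | h1 u != h2 u] /\ P (U @^-1` [set u | h1 u != h2 u]) = 0%E.
Proof.
move=> mU [mh1 ih1 h1E] [mh2 ih2 h2E].
have mN : measurable [set u | h1 u != h2 u].
  rewrite [X in measurable X](_ : _ = 
      setT `&` [set u | (EFin \o h1) u != (EFin \o h2) u]).
    by apply: measurable_neqe => //; exact/measurable_EFinP.
  by rewrite setTI; apply/seteqP; split => u /=; rewrite eqe.
split => //.
pose m1 := mpushforward P mU.
have pushE (h : T1 -> R) : measurable_fun setT h ->
    P.-integrable setT (EFin \o (h \o U)) -> forall B, measurable B ->
    (\int[m1]_(u in B) (EFin \o h) u = \int[P]_(w in U @^-1` B) (h (U w))%:E)%E.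
  move=> mh ih B mB; rewrite integral_pushforward//; first exact/measurable_EFinP.
  apply: (integrableS _ _ _ ih) => //.
  by rewrite -[X in measurable X]setTI; exact: (mU measurableT).
have : ae_eq m1 setT (EFin \o h1) (EFin \o h2).
  apply: integral_ae_eq => //.
  - by apply: integrable_pushforward => //; apply/measurable_EFinP.
  - exact/measurable_EFinP.
  - move=> B _ mB.
    by rewrite !pushE// h1E// h2E.
move=> [N [mN' N0 sub]].
apply/eqP; rewrite -measure_le0 -[leRHS]N0; apply: le_measure; rewrite ?inE//.
- by rewrite -[X in measurable X]setTI; exact: (mU measurableT).
- by rewrite -[X in measurable X]setTI; exact: (mU measurableT).
- by move=> w /= /eqP h; apply: sub => /= /(_ I) [] /h.
Qed.

(** The probability of the event is the mean over [X] of the masses of the sections, and a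
    nonnegative function with zero mean vanishes almost everywhere. This carries almost sure facts
    over to a fixed [x]. *)
Lemma ae_xsection_null {d d1 d2 : measure_display} {Omega : measurableType d}
    {T1 : measurableType d1} {T2 : measurableType d2} {R : realType}
    (P : probability Omega R) (X : {RV P >-> T1}) (V : Omega -> T2)
    (K : R.-pker T1 ~> T2) (N : set (T1 * T2)) :
  measurable_fun setT V -> is_cond_law P X V K -> measurable N ->
  P ((fun w => (X w, V w)) @^-1` N) = 0%E ->
  {ae distribution P X, forall x, K x (xsection N x) = 0%E}.
Proof.
move=> mV KV mN; rewrite (law_graph _ _ _ mV _ KV)//.
have mKN : measurable_fun setT (fun x => K x (xsection N x)).
  by apply: measurable_fun_xsection_finite_kernel; rewrite inE.
move=> KN0.
have := (ae_eq_integral_abs (distribution P X) measurableT mKN).1.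
under eq_integral do rewrite gee0_abs//.
rewrite ge0_integral_distribution// => /(_ KN0).
by apply: filterS => x; exact.
Qed.

(** Used to pass from the half-space indicator to [D], which equals it only almost surely. *)
Lemma is_cond_exp_ae {d d1 : measure_display} {Omega : measurableType d}
    {T1 : measurableType d1} {R : realType} (P : probability Omega R)
    (U : Omega -> T1) (W1 W2 : Omega -> R) (h : T1 -> R) :
  measurable_fun setT U -> measurable_fun setT W1 -> measurable_fun setT W2 ->
  {ae P, forall w, W1 w = W2 w} ->
  is_cond_exp P U W1 h -> is_cond_exp P U W2 h.
Proof.
move=> mU mW1 mW2 W12 [mh ih hE]; split => // B mB; rewrite hE//.
have mUB : measurable (U @^-1` B).
  by rewrite -[X in measurable X]setTI; exact: (mU measurableT).
apply: ae_eq_integral => //.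
- by apply/measurable_EFinP; exact: measurable_funTS.
- by apply/measurable_EFinP; exact: measurable_funTS.
- by apply: filterS W12 => w -> _.
Qed.

(** * Hyperplanes and half-spaces *)

Section hyperplanes.
Context {R : realType}.

Definition dotv {n : nat} (u v : 'rV[R]_n) : R := \sum_(i < n) u ord0 i * v ord0 i.

Lemma dotvZl n (a : R) (u v : 'rV[R]_n) : dotv (a *: u) v = a * dotv u v.
Proof. by rewrite /dotv mulr_sumr; apply: eq_bigr => i _; rewrite mxE mulrA. Qed.

Lemma dotvNr n (u v : 'rV[R]_n) : dotv u (- v) = - dotv u v.
Proof. by rewrite /dotv -sumrN; apply: eq_bigr => i _; rewrite mxE mulrN. Qed.

Lemma dotvBr n (u v w : 'rV[R]_n) : dotv u (v - w) = dotv u v - dotv u w.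
Proof.
by rewrite /dotv -sumrB; apply: eq_bigr => i _; rewrite !mxE mulrBr.
Qed.

Lemma dotvC n (u v : 'rV[R]_n) : dotv u v = dotv v u.
Proof. by apply: eq_bigr => i _; rewrite mulrC. Qed.

Lemma dotv0l n (v : 'rV[R]_n) : dotv 0 v = 0.
Proof. by rewrite /dotv big1// => i _; rewrite mxE mul0r. Qed.

Lemma dotv_rV_cons n (a : R) (u : 'rV[R]_n) (v : 'rV[R]_n.+1) :
  dotv (rV_cons a u) v =
  a * v ord0 ord0 + dotv u (\row_i v ord0 (lift ord0 i)).
Proof.
rewrite /dotv big_ord_recl rV_cons0; congr (_ + _).
by apply: eq_bigr => i _; rewrite rV_consS mxE.
Qed.

Lemma measurable_dotv n :
  measurable_fun setT (fun z : 'rV[R]_n * 'rV[R]_n => dotv z.1 z.2).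
Proof.
apply: measurable_sum => i; apply: measurable_funM.
  exact: (measurableT_comp (measurable_coor i) measurable_fst).
exact: (measurableT_comp (measurable_coor i) measurable_snd).
Qed.

Lemma measurable_dotvl n (s : 'rV[R]_n) :
  measurable_fun setT (fun v : 'rV[R]_n => dotv v s).
Proof.
exact: (measurableT_comp (measurable_dotv n) (pair2_measurable s)).
Qed.

Lemma measurable_hyperplane n (s : 'rV[R]_n) :
  measurable [set v : 'rV[R]_n | dotv v s = 0].
Proof.
rewrite -[X in measurable X]setTI.
by apply: (measurable_dotvl _ s measurableT [set 0]); exact: measurable_set1.
Qed.

(** Induction on the dimension. The sections of a hyperplane are lower-dimensional hyperplanes if
    the first coordinate of [s] vanishes; otherwise every line along the first axis meets it in one
    point. *)
Lemma lebesgue_hyperplane n (s : 'rV[R]_n) : s != 0 ->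
  lebesgue_rV n [set v | dotv v s = 0] = 0%E.
Proof.
elim: n s => [s /eqP[]|n IH s s0]; first by apply/rowP => -[].
pose A := [set q : measurableTypeR R * 'rV[R]_n | dotv (rV_cons q.1 q.2) s = 0].
have mA : measurable A.
  rewrite -[X in measurable X]setTI.
  suff mf : measurable_fun setT
      (fun q : measurableTypeR R * 'rV[R]_n => dotv (rV_cons q.1 q.2) s).
    by apply: (mf measurableT [set 0]); exact: measurable_set1.
  apply: (measurableT_comp (measurable_dotvl _ s)).
  exact: measurable_rV_cons.
(* By construction the measure in dimension [n.+1] is the image of this product, and [A] is the
   preimage of the hyperplane. *)
rewrite -[LHS]/((lebesgue_measure \x lebesgue_rV n)%E A).
have [s00|s00] := eqVneq (s ord0 ord0) 0.
  apply: integral0_eq => a _; rewrite /= xsectionE.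
  rewrite [X in lebesgue_rV _ X](_ : _ =
      [set v | dotv v (\row_i s ord0 (lift ord0 i)) = 0]).
    apply: IH; apply: contra s0 => /eqP t0; apply/eqP/rowP => i; rewrite mxE.
    have [j ->|->//] := unliftP ord0 i.
    by move/rowP : t0 => /(_ j); rewrite !mxE.
  by apply/seteqP; split => v; rewrite /A/= dotv_rV_cons s00 mulr0 add0r.
(* The order of integration is exchanged so that the first coordinate, determined by the others, is
   integrated innermost. *)
rewrite (_ : _ A = (lebesgue_measure \x^ lebesgue_rV n)%E A); last first.
  by apply: product_measure_unique => // B C mB mC; exact: product_measure2E.
apply: integral0_eq => v _; rewrite /= ysectionE.
rewrite [X in lebesgue_measure X](_ : _ =
    [set - dotv v (\row_i s ord0 (lift ord0 i)) / s ord0 ord0]).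
  exact: lebesgue_measure_set1.
apply/seteqP; split => a; rewrite /A/= dotv_rV_cons.
  by move/eqP; rewrite addr_eq0 => /eqP <-; rewrite mulfK.
by move=> ->; rewrite divfK// addNr.
Qed.

(** A hyperplane through the origin is a cone: if [unitv v] lies in it and [v] is in the punctured
    ball, so does [v]. The Lebesgue bound then applies. *)
Lemma sphere_measure_hyperplane n (s : 'rV[R]_n) : s != 0 ->
  sphere_measure n [set v | dotv v s = 0] = 0%E.
Proof.
move=> s0; rewrite /sphere_measure.
rewrite (_ : lebesgue_rV n _ = 0%E) ?mule0//.
apply/eqP; rewrite -measure_le0 -(lebesgue_hyperplane _ _ s0).
apply: le_measure; rewrite ?inE.
- apply: measurableI; last exact: measurable_punctured_ball.
  rewrite -[X in measurable X]setTI; apply: measurable_unitv => //.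
  exact: measurable_hyperplane.
- exact: measurable_hyperplane.
- move=> v [/= + /andP[v0 _]]; rewrite /unitv dotvZl => /eqP.
  by rewrite mulf_eq0 invr_eq0 gt_eqF//= => /eqP.
Qed.

End hyperplanes.

(** * Half-space integrals as functions of the normal vector *)

Section halfspace_integrals.
Context {d : measure_display} {T : measurableType d} {R : realType} {n : nat}.
Variables (mu : {measure set T -> \bar R}) (mu1 : mu setT = 1%E).
Variables (G : T -> 'rV[R]_n) (mG : measurable_fun setT G).
Variables (phi : T -> R) (mphi : measurable_fun setT phi).
Variables (M : R) (phiM : forall t, `|phi t| <= M).

Let halfspace (s : 'rV[R]_n) := [set t | 0 < dotv (G t) s].

Definition halfspace_integral (s : 'rV[R]_n) : R :=
  fine (\int[mu]_t (phi t * \1_(halfspace s) t)%:E)%E.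

Let mem_halfspace s t : (t \in halfspace s) = (0 < dotv (G t) s).
Proof. by apply/idP/idP; rewrite inE. Qed.

Let mdot s : measurable_fun setT (fun t => dotv (G t) s).
Proof. exact: (measurableT_comp (measurable_dotvl _ s) mG). Qed.

Let mhalfspace s : measurable (halfspace s).
Proof.
rewrite -[X in measurable X]setTI (_ : halfspace s =
  (fun t => dotv (G t) s) @^-1` `]0, +oo[%classic).
  by apply: mdot => //; exact: measurable_itv.
by apply/seteqP; split => t /=; rewrite in_itv/= andbT.
Qed.

Let mintegrand s : measurable_fun setT (fun t => phi t * \1_(halfspace s) t).
Proof. by apply: measurable_funM => //; exact: measurable_indic. Qed.

Let integrand_le s t : `|phi t * \1_(halfspace s) t| <= M.
Proof.
rewrite normrM indicE; case: (_ \in _).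
  by rewrite normr1 mulr1.
by rewrite normr0 mulr0 (le_trans _ (phiM t)).
Qed.

Let iintegrand s :
  mu.-integrable setT (fun t => (phi t * \1_(halfspace s) t)%:E).
Proof. exact: (bounded_integrable _ mu1 _ _ (mintegrand s) (integrand_le s)). Qed.

Let halfspace_integralE s : (halfspace_integral s)%:E =
  (\int[mu]_t (phi t * \1_(halfspace s) t)%:E)%E.
Proof. by rewrite fineK//; apply: integrable_fin_num. Qed.

(* The points whose membership in the half-space {g | 0 < <g, s>} can change
   when [s0] moves by at most [1 / (k + 1)] in maximum norm. *)
Let slab s0 (k : nat) :=
  [set t | `|dotv (G t) s0| <= k.+1%:R^-1 * \sum_(i < n) `|G t ord0 i|].

Let mslab s0 k : measurable (slab s0 k).
Proof.
rewrite -[X in measurable X]setTI.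
apply: (measurable_fun_ler (f := fun t => `|dotv (G t) s0|)
  (g := fun t => k.+1%:R^-1 * \sum_(i < n) `|G t ord0 i|)) => //.
  exact: measurableT_comp.
apply: measurable_funM => //; apply: measurable_sum => i.
apply: measurableT_comp => //.
exact: (measurableT_comp (measurable_coor i) mG).
Qed.

Let slab_fin s0 k : (mu (slab s0 k) < +oo)%E.
Proof.
apply: (@le_lt_trans _ _ (mu setT)); last by rewrite mu1 ltry.
by apply: le_measure; rewrite ?inE.
Qed.

(** The slabs decrease to the hyperplane, and a finite measure is continuous from above. *)
Let slab_cvg s0 : mu [set t | dotv (G t) s0 = 0] = 0%E ->
  mu (slab s0 k) @[k --> \oo] --> 0%E.
Proof.
move=> mu0; rewrite (_ : 0%E = mu (\bigcap_k slab s0 k)).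
  apply: nonincreasing_cvg_mu => //.
  - exact: bigcapT_measurable.
  - move=> k l kl; apply/subsetPset => t /= /le_trans; apply.
    rewrite ler_wpM2r ?sumr_ge0// lef_pV2 ?posrE// ler_nat ltnS//.
rewrite -mu0; congr (mu _); apply/seteqP; split => t /=.
  by move=> t0 k _; rewrite /slab/= t0 normr0 mulr_ge0// sumr_ge0.
move=> tslab; apply/eqP; apply: contraT => t0.
pose C := \sum_(i < n) `|G t ord0 i|.
(* For this index, [k.+1] exceeds [C] divided by the absolute inner product, so [t] is outside the
   slab. *)
have := tslab (Num.truncn (C / `|dotv (G t) s0|)) I => /=.
rewrite /slab/= mulrC ler_pdivlMr// leNgt => /negP[].
by rewrite mulrC -ltr_pdivrMr ?normr_gt0//; exact: truncnS_gt.
Qed.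

(** If the two sign tests differ, zero lies between the two inner products, so the one with [s0] is
    at most their difference in absolute value; that difference is bounded coordinatewise. *)
Let slabP (s0 s : 'rV[R]_n) k :
  (forall i, `|s0 ord0 i - s ord0 i| <= k.+1%:R^-1) ->
  forall t, t \in halfspace s0 != (t \in halfspace s) -> slab s0 k t.
Proof.
move=> s0s t ts.
apply: (@le_trans _ _ `|dotv (G t) (s0 - s)|).
  move: ts; rewrite !mem_halfspace dotvBr.
  case: (ltP 0 (dotv (G t) s0)) => a; case: (ltP 0 (dotv (G t) s)) => b // _.
    by rewrite !ger0_norm; lra.
  by rewrite !ler0_norm; lra.
rewrite /dotv mulr_sumr (le_trans (ler_norm_sum _ _ _))//.
apply: ler_sum => i _; rewrite normrM mulrC !mxE.
by rewrite ler_wpM2r// s0s.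
Qed.

(** The integrands differ only on the slab, and there by at most [M]. *)
Let halfspace_integral_dist (s0 s : 'rV[R]_n) k :
  (forall i, `|s0 ord0 i - s ord0 i| <= k.+1%:R^-1) ->
  (`|halfspace_integral s0 - halfspace_integral s|%:E <= M%:E * mu (slab s0 k))%E.
Proof.
move=> s0s; rewrite -abse_EFin EFinB !halfspace_integralE -integralB//.
apply: le_trans (le_abse_integral _ _ _) _ => //.
  by apply: emeasurable_funB; exact/measurable_EFinP.
rewrite -integral_cst// [leRHS]integral_mkcond.
apply: ge0_le_integral => //.
- by apply: measurableT_comp => //; apply: emeasurable_funB; exact/measurable_EFinP.
- by apply/(measurable_restrictT _ _).1 => //; exact: measurable_cst.
- move=> t _; rewrite -EFinB abse_EFin -mulrBr patchE.
  case: ifPn => tslab.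
    rewrite lee_fin normrM (le_trans _ (phiM t))// ler_piMr// !indicE.
    by do 2!case: (_ \in _); rewrite ?subrr ?subr0 ?sub0r ?normrN ?normr1 ?normr0.
  rewrite !indicE; have [->|/(slabP _ _ _ s0s)] :=
    eqVneq (t \in halfspace s0) (t \in halfspace s).
    by rewrite subrr mulr0 normr0.
  by move=> /mem_set; rewrite (negbTE tslab).
Qed.

Lemma halfspace_integral_continuous (s0 : 'rV[R]_n) :
  mu [set t | dotv (G t) s0 = 0] = 0%E ->
  halfspace_integral s @[s --> s0] --> halfspace_integral s0.
Proof.
move=> mu0; apply/(@cvgrPdist_le _ _ _ _ (nbhs_filter s0)) => e e0.
have M0 : 0 <= M by rewrite (le_trans _ (phiM point)).
(* Dividing by [M + 1] keeps the tolerance well defined and positive when [M] is zero. *)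
have /fine_cvgP[_ /cvgrPdist_le/(_ (e / (M + 1)))] := slab_cvg s0 mu0.
have M1 : 0 < M + 1 by rewrite ltr_wpDl.
move=> /(_ (divr_gt0 e0 M1)) [k _ /(_ k (leqnn k)) /=].
rewrite sub0r normrN => slabk.
have finslab : mu (slab s0 k) \is a fin_num.
  by rewrite ge0_fin_numE.
near=> s.
rewrite -lee_fin; apply: le_trans (halfspace_integral_dist s0 s k _) _.
  move=> i; apply: ltW.
  have : ball s0 k.+1%:R^-1 s.
    by near: s; apply: nbhsx_ballx; rewrite invr_gt0.
  by move=> [_ /(_ ord0 i)].
rewrite -(fineK finslab) -EFinM lee_fin.
apply: (@le_trans _ _ ((M + 1) * (e / (M + 1)))); last first.
  by rewrite mulrC divfK// gt_eqF.
apply: ler_pM => //; first by rewrite lerDl.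
exact: le_trans (ler_norm _) slabk.
Unshelve. all: by end_near. Qed.

(** Off the hyperplane, exactly one of the strict inequalities for [s0] and [- s0] holds, so the two
    integrands add up to [phi]. *)
Lemma halfspace_integralDN s0 :
  mu [set t | dotv (G t) s0 = 0] = 0%E ->
  (halfspace_integral s0 + halfspace_integral (- s0))%:E =
  (\int[mu]_t (phi t)%:E)%E.
Proof.
move=> mu0; rewrite EFinD !halfspace_integralE -integralD//.
apply: ae_eq_integral => //.
- by apply: emeasurable_funD; exact/measurable_EFinP.
- exact/measurable_EFinP.
exists [set t | dotv (G t) s0 = 0]; split => //.
  by rewrite -[X in measurable X]setTI; apply: (mdot _ _ [set 0]).
move=> t /= /not_implyP[_]; apply: contra_notP => /eqP t0.
rewrite -EFinD -mulrDr !indicE !mem_halfspace dotvNr oppr_gt0.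
by case: ltgtP t0 => //= _ _; rewrite ?addr0 ?add0r mulr1.
Qed.

End halfspace_integrals.

(** * The model *)

Section support.
Context {R : realType} {n : nat}.

(** The sigma-algebra is generated by coordinates rather than by open sets; a ball of the maximum
    norm is a finite intersection of coordinate conditions. *)
Lemma measurable_rV_ball (s : 'rV[R]_n.+1) (e : R) :
  0 < e -> measurable (ball s e).
Proof.
move=> e0.
rewrite (_ : ball s e = \bigcap_(i in [set: 'I_n.+1])
    (fun t : 'rV[R]_n.+1 => t ord0 i) @^-1` ball (s ord0 i) e).
  apply: fin_bigcap_measurable => // i _.
  rewrite -[X in measurable X]setTI; apply: measurable_coor => //.
  exact: measurable_ball.
apply/seteqP; split => t; first by move=> [_ st] i _; exact: st.
by move=> st; split => // i j; rewrite ord1; exact: st.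
Qed.

(** If the functions differed at a point of the support, continuity would make them differ on the
    support near it. A small ball would then be covered by two null sets, although it has positive
    mass. *)
Lemma eq_on_msupport (mu : {measure set 'rV[R]_n.+1 -> \bar R})
    (h1 h2 : 'rV[R]_n.+1 -> R) :
  measurable (msupport mu) -> mu (~` msupport mu) = 0%E ->
  measurable [set s | h1 s != h2 s] -> mu [set s | h1 s != h2 s] = 0%E ->
  (forall s, msupport mu s -> h1 t @[t --> within (msupport mu) (nbhs s)] --> h1 s) ->
  (forall s, msupport mu s -> h2 t @[t --> within (msupport mu) (nbhs s)] --> h2 s) ->
  forall s, msupport mu s -> h1 s = h2 s.
Proof.
move=> mA A0 mN N0 h1c h2c s As; apply/eqP; rewrite -subr_eq0; apply: contraT => d0.
have : nbhs s [set t | msupport mu t -> h1 t - h2 t != 0].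
  exact: cvgr_neq0 _ (cvgB (h1c s As) (h2c s As)) d0.
move=> /nbhs_ballP[e /= e0 sub].
have := As (ball s e) (ball_open s e) (ballxx s e0).
have mU : measurable (ball s e) by exact: measurable_rV_ball.
suff -> : mu (ball s e) = 0%E by rewrite ltxx.
apply/eqP; rewrite -measure_le0.
apply: (@le_trans _ _ (mu (~` msupport mu `|` [set s | h1 s != h2 s]))).
  apply: le_measure; rewrite ?inE//; first by apply: measurableU => //; exact: measurableC.
  move=> t st; have [At|At] := pselect (msupport mu t); last by left.
  by right => /=; rewrite -subr_eq0; exact: (sub t st At).
apply: le_trans (measureU2 _ _ _) _ => //; first exact: measurableC.
by rewrite [X in (X + _)%E]A0 [X in (_ + X)%E]N0 adde0.
Qed.

Lemma measurable_Hplus : measurable (@Hplus R n).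
Proof.
rewrite (_ : Hplus n = (setT `&` @enorm R n.+1 @^-1` [set 1]) `&`
    (setT `&` (fun s : 'rV[R]_n.+1 => s ord0 ord0) @^-1` `[0, +oo[%classic)).
  apply: measurableI.
    by apply: measurable_enorm => //; exact: measurable_set1.
  by apply: measurable_coor => //; exact: measurable_itv.
by rewrite !setTI; apply/seteqP; split => s /=; rewrite in_itv/= andbT.
Qed.

End support.

(** * Normalised vectors and the selection rule *)

Section model_facts.
Context {R : realType} {n : nat}.

Lemma enorm_ge0 m (v : 'rV[R]_m) : 0 <= enorm v.
Proof. exact: sqrtr_ge0. Qed.

Lemma enorm_eq0 m (v : 'rV[R]_m) : (enorm v == 0) = (v == 0).
Proof.
rewrite /enorm sqrtr_eq0; apply/idP/idP => [v0|/eqP ->]; last first.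
  by rewrite big1// => i _; rewrite mxE expr0n.
apply/eqP/rowP => i; rewrite mxE.
have /eqP : \sum_(i < m) v ord0 i ^+ 2 == 0.
  by rewrite eq_le v0 sumr_ge0// => j _; exact: sqr_ge0.
by move=> /psumr_eq0P => /(_ (fun j _ => sqr_ge0 _) i isT)/eqP; rewrite sqrf_eq0 => /eqP.
Qed.

Lemma enormZ m (a : R) (v : 'rV[R]_m) : enorm (a *: v) = `|a| * enorm v.
Proof.
rewrite /enorm -sqrtr_sqr -sqrtrM ?sqr_ge0//; congr Num.sqrt.
by rewrite mulr_sumr; apply: eq_bigr => i _; rewrite mxE exprMn.
Qed.

Lemma enorm_unitv m (v : 'rV[R]_m) : v != 0 -> enorm (unitv v) = 1.
Proof.
move=> v0; have e0 : 0 < enorm v by rewrite lt_def enorm_eq0 v0 enorm_ge0.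
by rewrite /unitv enormZ ger0_norm ?invr_ge0 ?enorm_ge0// mulVf// gt_eqF.
Qed.

Lemma rV_cons_eq0 (a : R) (v : 'rV[R]_n) :
  (rV_cons a v == 0) = (a == 0) && (v == 0).
Proof.
apply/eqP/andP => [av0|[/eqP -> /eqP ->]].
  split; first by rewrite -(rV_cons0 _ a v) av0 mxE.
  by apply/eqP/rowP => i; rewrite -(rV_consS _ a v) av0 !mxE.
apply/rowP => i; have [j ->|->] := unliftP ord0 i.
  by rewrite rV_consS !mxE.
by rewrite rV_cons0 mxE.
Qed.

Lemma Svec_Hplus (T : Type) (Z : T -> 'rV[R]_n) w : Hplus n (Svec Z w).
Proof.
have c0 : rV_cons 1 (Z w) != 0 by rewrite rV_cons_eq0 oner_eq0.
split; first exact: enorm_unitv.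
by rewrite /Svec /unitv mxE rV_cons0 mulr1 invr_ge0 enorm_ge0.
Qed.

(** Normalising divides by positive numbers and so preserves the sign; when [A w] and [B w] both
    vanish, both inequalities are false. *)
Lemma Gamma_Svec_gt0 (T : Type) (A : T -> R) (B Z : T -> 'rV[R]_n) w :
  (0 < dotv (Gamma A B w) (Svec Z w)) =
  (0 < A w + (B w *m (Z w)^T) ord0 ord0).
Proof.
have c0 : rV_cons 1 (Z w) != 0 by rewrite rV_cons_eq0 oner_eq0.
have ez : 0 < enorm (rV_cons 1 (Z w)) by rewrite lt_def enorm_eq0 c0 enorm_ge0.
have -> : A w + (B w *m (Z w)^T) ord0 ord0 =
    dotv (rV_cons (A w) (B w)) (rV_cons 1 (Z w)).
  rewrite dotv_rV_cons rV_cons0 mulr1; congr (_ + _).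
  by rewrite mxE; apply: eq_bigr => i _; rewrite [_^T _ _]mxE [in RHS]mxE rV_consS.
rewrite /Gamma; have [->|ab0] := eqVneq (rV_cons (A w) (B w)) 0.
  by rewrite mulr0n !dotv0l.
have eab : 0 < enorm (rV_cons (A w) (B w)).
  by rewrite lt_def enorm_eq0 ab0 enorm_ge0.
rewrite mulr1n /Svec /unitv dotvZl dotvC dotvZl dotvC.
by rewrite !pmulr_rgt0 ?invr_gt0.
Qed.

Lemma measurable_Svec {d : measure_display} {T : measurableType d}
    (Z : T -> 'rV[R]_n) :
  measurable_fun setT Z -> measurable_fun setT (Svec Z).
Proof.
move=> mZ; apply: (measurableT_comp (measurable_unitv n.+1)).
exact: measurable_rV_cons.
Qed.

Lemma measurable_Gamma {d : measure_display} {T : measurableType d}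
    (A : T -> R) (B : T -> 'rV[R]_n) :
  measurable_fun setT A -> measurable_fun setT B ->
  measurable_fun setT (Gamma A B).
Proof.
move=> mA mB; have mAB := measurable_rV_cons n _ _ mA mB.
have -> : Gamma A B = fun w => unitv (rV_cons (A w) (B w)).
  apply/funext => w; rewrite /Gamma.
  have [->|_] := eqVneq (rV_cons (A w) (B w)) 0; last by rewrite mulr1n.
  by rewrite mulr0n /unitv scaler0.
exact: (measurableT_comp (measurable_unitv n.+1) mAB).
Qed.

End model_facts.

(** A measure with a density inherits the null sets of the reference measure. *)
Lemma density_hyperplane {R : realType} {n : nat} (nu : set 'rV[R]_n -> \bar R)
    (f : 'rV[R]_n -> R) (s : 'rV[R]_n) :
  is_density (sphere_measure n) nu f -> s != 0 ->
  nu [set v | dotv v s = 0] = 0%E.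
Proof.
move=> [mf _ nuE] s0; rewrite nuE; last exact: measurable_hyperplane.
apply: null_set_integral.
- exact: measurable_hyperplane.
- by apply/measurable_EFinP; exact: measurable_funTS.
- exact: sphere_measure_hyperplane.
Qed.

Lemma sphere_neq0 {R : realType} {n : nat} (s : 'rV[R]_n) :
  sphere n s -> s != 0.
Proof. by move=> s1; rewrite -enorm_eq0 s1 oner_eq0. Qed.

Lemma bdHplus_Hplus {R : realType} {n : nat} : @bdHplus R n `<=` @Hplus R n.
Proof. by move=> s [s1 s0]; split => //; rewrite s0. Qed.

Lemma bdHplusN {R : realType} {n : nat} (s : 'rV[R]_n.+1) :
  bdHplus n s -> bdHplus n (- s).
Proof.
move=> [s1 s0]; split; last by rewrite mxE s0 oppr0.
by rewrite /sphere/= -scaleN1r enormZ normrN1 mul1r.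
Qed.

(** [D] is the binary selection variable, [R] being the real field. The existence half ensures that
    the claim about every continuous version is not vacuous. The exceptional set of [x] is
    independent of the boundary point [s0]. *)
Theorem theorem2 (R : realType) (n p : nat) (d_ge2 : (2 <= n.+1)%N)
    (disp : measure_display) (Omega : measurableType disp)
    (P : probability Omega R)
    (Y D A : {RV P >-> R}) (X : {RV P >-> 'rV[R]_p})
    (Z B : {RV P >-> 'rV[R]_n})
    (D01 : forall w, D w = 0 \/ D w = 1)
    (DE : {ae P, forall w,
       D w = (0 < A w + (B w *m (Z w)^T) ord0 ord0 :> R)%:R})
    (K : R.-pker 'rV[R]_p ~> ('rV[R]_n.+1 * ('rV[R]_n.+1 * R))%type)
    (K_law : is_cond_law P X (fun w => (Svec Z w, (Gamma A B w, Y w))) K)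
    (f : 'rV[R]_p -> 'rV[R]_n.+1 -> R)
    (Ha : {ae distribution P X, forall x, lawG (K x) [set 0] = 0%E})
    (Hb : {ae distribution P X, forall x, forall C E,
       measurable C -> measurable E ->
       K x (C `*` E) = (lawS (K x) C * lawGY (K x) E)%E})
    (Hc : {ae distribution P X, forall x,
       is_density (sphere_measure n.+1) (lawG (K x)) (f x) /\
       f x \in Lfun (sphere_measure n.+1) 2%:E})
    (Hd : {ae distribution P X, forall x,
       {ae sphere_measure n.+1, forall g, f x g * f x (- g) = 0}})
    (He : {ae distribution P X, forall x, msupport (lawS (K x)) = Hplus n})
    (phi : R -> R) (phi_meas : measurable_fun setT phi)
    (phi_bdd : exists M, forall y, `|phi y| <= M) :
  let is_cont_version (h : 'rV[R]_p * 'rV[R]_n.+1 -> R) :=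
    is_cond_exp P (fun w => (X w, Svec Z w)) (fun w => phi (Y w) * D w) h /\
    {ae distribution P X, forall x,
      {within msupport (lawS (K x)), continuous (fun s => h (x, s))}} in
  (exists h, is_cont_version h) /\
  forall m h,
    is_cond_exp P X (fun w => phi (Y w)) m ->
    is_cont_version h ->
    {ae distribution P X, forall x, forall s0, bdHplus n s0 ->
      [/\ cvg (h (x, s) @[s --> within (Hplus n) (nbhs s0)]),
          cvg (h (x, s) @[s --> within (Hplus n) (nbhs (- s0))]) &
          m x = lim (h (x, s) @[s --> within (Hplus n) (nbhs s0)]) +
                lim (h (x, s) @[s --> within (Hplus n) (nbhs (- s0))])]}.
Proof.
move=> is_cont_version; have [M phiM] := phi_bdd.
pose S := Svec Z.
pose V w := (Gamma A B w, Y w).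
have mS : measurable_fun setT S by exact: measurable_Svec.
have mV : measurable_fun setT V.
  by apply: measurable_fun_pair => //; exact: measurable_Gamma.
have mSV : measurable_fun setT (fun w => (S w, V w)).
  exact: measurable_fun_pair.
have mXS : measurable_fun setT (fun w => (X w, S w)).
  exact: measurable_fun_pair.
pose pos := [set z : 'rV[R]_n.+1 * 'rV[R]_n.+1 | 0 < dotv z.1 z.2].
have mpos : measurable pos.
  rewrite -[X in measurable X]setTI (_ : pos =
    (fun z : 'rV[R]_n.+1 * 'rV[R]_n.+1 => dotv z.1 z.2) @^-1` `]0, +oo[%classic).
    by apply: measurable_dotv => //; exact: measurable_itv.
  by apply/seteqP; split => z /=; rewrite in_itv/= andbT.
(* The selected outcome as a function of [x], [s] and the pair of [Gamma] and [Y], in the shape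
   required for freezing. *)
pose F (z : ('rV[R]_p * 'rV[R]_n.+1) * ('rV[R]_n.+1 * R)) :=
  phi z.2.2 * \1_pos (z.2.1, z.1.2).
have mF : measurable_fun setT F.
  apply: measurable_funM.
    exact: (measurableT_comp phi_meas (measurableT_comp measurable_snd measurable_snd)).
  apply: (measurableT_comp (measurable_indic mpos)).
  apply: measurable_fun_pair.
    exact: (measurableT_comp measurable_fst measurable_snd).
  exact: (measurableT_comp measurable_snd measurable_fst).
have FM z : `|F z| <= M.
  rewrite normrM indicE; case: (_ \in _); first by rewrite normr1 mulr1.
  by rewrite normr0 mulr0 (le_trans _ (phiM 0)).
(* The explicit version: [s] is a parameter, and only [Gamma] and [Y] are averaged under [K x]. *)
pose h0 := kmean (kprecomp K fst measurable_fst) (fun u => F (u.1, u.2.2)).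
have ceF : is_cond_exp P (fun w => (X w, S w)) (fun w => F ((X w, S w), V w)) h0.
  apply: (is_cond_exp_kmean P _ V _ snd F M) => //.
  move=> G mG G0.
  exact: (ge0_freezing P X S V mS mV K K_law Hb).
have mphiY : measurable_fun setT (fun w => phi (Y w)) by exact: measurableT_comp.
have ce0 : is_cond_exp P (fun w => (X w, S w)) (fun w => phi (Y w) * D w) h0.
  apply: is_cond_exp_ae ceF => //.
  - apply: (measurableT_comp mF); exact: measurable_fun_pair.
  - exact: measurable_funM.
  - apply: filterS DE => w ->; rewrite /F/= indicE; congr (_ * _%:R).
    by rewrite -(Gamma_Svec_gt0 _ A B Z w); congr nat_of_bool; apply/idP/idP; rewrite inE.
have h0E x s : h0 (x, s) =
    halfspace_integral (K x) (fun v => v.2.1) (fun v => phi v.2.2) s.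
  by [].
(* The exceptional set of [x] is chosen before [s], so it serves all hyperplanes at once. *)
have Kgood : {ae distribution P X, forall x s, s != 0 ->
    K x [set v | dotv v.2.1 s = 0] = 0%E}.
  by apply: filterS Hc => x [fx _] s s0; exact: (density_hyperplane _ _ _ fx s0).
have mG1 : measurable_fun setT
    (fun v : 'rV[R]_n.+1 * ('rV[R]_n.+1 * R) => v.2.1).
  exact: (measurableT_comp measurable_fst measurable_snd).
have mphi1 : measurable_fun setT
    (fun v : 'rV[R]_n.+1 * ('rV[R]_n.+1 * R) => phi v.2.2).
  exact: (measurableT_comp phi_meas (measurableT_comp measurable_snd measurable_snd)).
have h0c : {ae distribution P X, forall x s, Hplus n s ->
    h0 (x, t) @[t --> s] --> h0 (x, s)}.
  apply: filterS Kgood => x Kx s [s1 _].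
  exact: (halfspace_integral_continuous (K x) (prob_kernel x) _ mG1 _ mphi1 M
    (fun v => phiM v.2.2) s (Kx s (sphere_neq0 s s1))).
split.
  exists h0; split => //.
  apply: filterS2 He h0c => x -> h0x.
  by apply/subspace_continuousP => s Hs; exact: cvg_within_filter (h0x s Hs).
move=> m h cem [ceh hc].
pose m0 := kmean K (fun u => phi u.2.2.2).
have mphi2 : measurable_fun setT
    (fun u : 'rV[R]_p * ('rV[R]_n.+1 * ('rV[R]_n.+1 * R)) => phi u.2.2.2).
  exact: (measurableT_comp mphi1 measurable_snd).
have cem0 : is_cond_exp P X (fun w => phi (Y w)) m0.
  apply: (is_cond_exp_kmean P X (fun w => (S w, V w)) _ idfun
    (fun u => phi u.2.2.2) M) => //.
    exact: measurable_id.
  move=> G mG G0; exact: (ge0_disintegration P X _ mSV K K_law G mG G0).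
have mX : measurable_fun setT X by [].
have [mNm Nm] := is_cond_exp_unique P X _ m m0 mX cem cem0.
have [mNh Nh] := is_cond_exp_unique P _ _ h h0 mXS ceh ce0.
have aem : {ae distribution P X, forall x, m x = m0 x}.
  exists [set x | m x != m0 x]; split => //.
  by move=> x /= /eqP.
(* The disagreement set of the two versions, null for the law of [X] and [S], is lifted to the space
   of [K] by leaving [Gamma] and [Y] free. *)
have aeh : {ae distribution P X, forall x,
    lawS (K x) [set s | h (x, s) != h0 (x, s)] = 0%E}.
  pose N := [set z : 'rV[R]_p * ('rV[R]_n.+1 * ('rV[R]_n.+1 * R)) |
    h (z.1, z.2.1) != h0 (z.1, z.2.1)].
  have mN : measurable N.
    rewrite -[X in measurable X]setTI.
    have mfst : measurable_fun setT
        (fun z : 'rV[R]_p * ('rV[R]_n.+1 * ('rV[R]_n.+1 * R)) => (z.1, z.2.1)).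
      apply: measurable_fun_pair => //.
      exact: (measurableT_comp measurable_fst measurable_snd).
    exact: (mfst measurableT _ mNh).
  have := ae_xsection_null P X _ K N mSV K_law mN Nh.
  by apply: filterS => x; rewrite xsectionE.
(* [Svec] takes all its values in [Hplus], so the conditional law of [S] gives no mass to the
   complement. *)
have aeH : {ae distribution P X, forall x, lawS (K x) (~` Hplus n) = 0%E}.
  pose N := [set z : 'rV[R]_p * ('rV[R]_n.+1 * ('rV[R]_n.+1 * R)) |
    (~` Hplus n) z.2.1].
  have mN : measurable N.
    rewrite -[X in measurable X]setTI.
    have mfst : measurable_fun setT
        (fun z : 'rV[R]_p * ('rV[R]_n.+1 * ('rV[R]_n.+1 * R)) => z.2.1).
      exact: (measurableT_comp measurable_fst measurable_snd).
    by apply: (mfst measurableT); apply: measurableC; exact: measurable_Hplus.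
  have N0 : P ((fun w => (X w, (S w, V w))) @^-1` N) = 0%E.
    rewrite (_ : _ @^-1` N = set0) ?measure0// -subset0 => w.
    by apply; exact: Svec_Hplus.
  have := ae_xsection_null P X _ K N mSV K_law mN N0.
  by apply: filterS => x; rewrite xsectionE.
apply: filterS3 (filterI He Kgood) (filterI hc h0c)
  (filterI aem (filterI aeh aeH)) => x.
move=> [Sx Kx] [hx h0x] [mx [hh0 SH]] s0 s0bd.
pose mu := mpushforward (K x) measurable_fst.
have muS : msupport mu = Hplus n := Sx.
have hxc s : Hplus n s -> h (x, t) @[t --> within (Hplus n) (nbhs s)] --> h (x, s).
  by move: hx; rewrite Sx => /subspace_continuousP; exact.
(* Both versions are continuous on the support and agree almost everywhere there, hence everywhere
   on [Hplus]. *)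
have hE s : Hplus n s -> h (x, s) = h0 (x, s).
  move=> Hs; apply: (eq_on_msupport mu (fun s => h (x, s)) (fun s => h0 (x, s)));
    rewrite ?muS//.
  - exact: measurable_Hplus.
  - have := measurable_xsection x mNh; rewrite xsectionE; exact.
  - by move=> t Ht; exact: cvg_within_filter (h0x t Ht).
(* Properness of these filters is what makes the limits unique, so that [lim] can be computed. *)
have prop (s : 'rV[R]_n.+1) :
    Hplus n s -> ProperFilter (within (@Hplus R n) (nbhs s)).
  by move=> Hs; apply: within_nbhs_proper; exact: subset_closure.
have Hs0 : Hplus n s0 by exact: bdHplus_Hplus.
have HNs0 : Hplus n (- s0) by apply: bdHplus_Hplus; exact: bdHplusN.
have c1 := hxc _ Hs0; have c2 := hxc _ HNs0.
split; [exact: cvgP c1|exact: cvgP c2|].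
have P1 := prop _ Hs0; have P2 := prop _ HNs0.
rewrite (cvg_lim _ c1)// (cvg_lim _ c2)// !hE// mx.
apply: EFin_inj.
(* The values at [s0] and [- s0] are integrals over opposite half-spaces; they add up to the full
   mean [m0 x]. *)
rewrite !h0E (halfspace_integralDN _ (prob_kernel x) _ mG1 _ mphi1 M
    (fun v => phiM v.2.2)); last first.
  by apply: Kx; apply: sphere_neq0; case: s0bd.
by rewrite (kmeanE K _ M).
Qed.
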